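(* Let $\{(\phi^n,v^n)\}_{n=0}^{N}$ and $\{\eta^{n-\frac12}\}_{n=1}^{N}$ satisfy the CN-SAV time-stepping scheme: for $1\leq n\leq N$, $$(\partial_{\tau}^{\alpha}\phi)^{n-\frac12}=-\lambda\left(-\varepsilon^{2}\Delta\phi^{n-\frac12}+\beta\phi^{n-\frac12}+V(\hat{\phi}^{n-\frac12})v^{n-\frac12}-\eta^{n-\frac12}\right),$$ $$\eta^{n-\frac12}=\frac{1}{|\Omega|}\int_{\Omega}\left(-\varepsilon^{2}\Delta\phi^{n-\frac12}+\beta\phi^{n-\frac12}+V(\hat{\phi}^{n-\frac12})v^{n-\frac12}\right)\mathrm{d}\mathbf{x},$$ $$\partial_{\tau}v^{n-\frac12}=\frac12\int_{\Omega}V(\hat{\phi}^{n-\frac12})\,\partial_{\tau}\phi^{n-\frac12}\,\mathrm{d}\mathbf{x}.$$ Then the scheme conserves the volume: $$\int_{\Omega}\phi^{n}\,\mathrm{d}\mathbf{x}=\int_{\Omega}\phi^{n-1}\,\mathrm{d}\mathbf{x}\quad\text{for } 1\leq n\leq N.$$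
   Context: Parameters: $0<\alpha<1$, $\lambda>0$ (mobility), $\varepsilon>0$ (interface width), $\beta$ a real regularization parameter, $C_0>0$ a constant. $\Omega\subset\mathbb{R}^d$ is a bounded rectangular domain with periodic boundary conditions, and $|\Omega|$ is its measure. The scheme is discrete in time only; the functions $\phi^n:\Omega\to\mathbb{R}$ are $\Omega$-periodic and sufficiently smooth in space for all expressions to make sense, while $v^n\in\mathbb{R}$ and $\eta^{n-\frac12}\in\mathbb{R}$ are scalars (constant in space). For a function $\phi$ on $\Omega$, $$V(\phi):=\frac{(\phi^{2}-1-\beta)\phi}{\sqrt{\int_{\Omega}\frac14(\phi^{2}-1-\beta)^{2}\,\mathrm{d}\mathbf{x}+C_{0}}}.$$ Time mesh: arbitrary nonuniform levels $0=t_0<t_1<\cdots<t_N=T$, steps $\tau_k:=t_k-t_{k-1}$, local step ratios $\rho_k:=\tau_k/\tau_{k+1}$. For a sequence $\{w^k\}$: $\triangledown_\tau w^k:=w^k-w^{k-1}$, $\partial_\tau w^{k-\frac12}:=\triangledown_\tau w^k/\tau_k$, $w^{k-\frac12}:=(w^k+w^{k-1})/2$ for $k\geq1$. L1$^+$ formula (approximating the Caputo derivative of order $\alpha$): $$(\partial_\tau^\alpha w)^{n-\frac12}:=\sum_{k=1}^n a_{n-k}^{(n)}\triangledown_\tau w^k,\qquad a_{n-k}^{(n)}:=\frac{1}{\tau_n\tau_k}\int_{t_{n-1}}^{t_n}\int_{t_{k-1}}^{\min\{t,t_k\}}\omega_{1-\alpha}(t-s)\,\mathrm{d}s\,\mathrm{d}t\quad(1\leq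 k\leq n),$$ where $\omega_{\mu}(t):=t^{\mu-1}/\Gamma(\mu)$. Extrapolation: $\hat\phi^{n-\frac12}:=\phi^{n-1}+\triangledown_\tau\phi^{n-1}/(2\rho_{n-1})$ for $n\geq2$; for $n=1$, $\hat\phi^{\frac12}$ is a prescribed smooth $\Omega$-periodic function (for instance $\phi^0$). Initial data: $\phi^0=\phi_0$ is given and $v^0=\sqrt{\int_{\Omega}\frac14(\phi_0^{2}-1-\beta)^{2}\,\mathrm{d}\mathbf{x}+C_{0}}$. *)

(* Defs.v *)
From HB Require Import structures.
From mathcomp Require Import all_boot all_order all_algebra.
From mathcomp Require Import all_classical all_reals all_analysis.

Set Implicit Arguments.
Unset Strict Implicit.
Unset Printing Implicit Defensive.

Import Order.TTheory GRing.Theory Num.Theory.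
Import numFieldNormedType.Exports.

Local Open Scope classical_set_scope.
Local Open Scope ring_scope.

(** ** Lebesgue measure on [R^d] *)

(* Row vectors carry the product sigma-algebra, generated by the coordinates. *)
Section measurable_row.
Context {R : realType} (d : nat).

Let coord (i : 'I_d) (x : 'rV[R]_d) : measurableTypeR R := x ord0 i.

Let row_set0 : g_sigma_preimage coord set0.
Proof. exact: sigma_algebra0. Qed.

Let row_setC A : g_sigma_preimage coord A -> g_sigma_preimage coord (~` A).
Proof. exact: sigma_algebraC. Qed.

Let row_bigcup (F : (set 'rV[R]_d)^nat) :
  (forall i, g_sigma_preimage coord (F i)) ->
  g_sigma_preimage coord (\bigcup_i F i).
Proof. exact: sigma_algebra_bigcup. Qed.

HB.instance Definition _ :=
  @isMeasurable.Build (measure_tuple_display default_measure_display) 'rV[R]_d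
    (g_sigma_preimage coord) row_set0 row_setC row_bigcup.

End measurable_row.

Section lebesgue_row.
Context {R : realType}.

Definition snoc (d : nat) (p : 'rV[R]_d * measurableTypeR R) : 'rV[R]_d.+1 :=
  \row_(i < d.+1) if unlift ord_max i is Some j then p.1 ord0 j else p.2.

Lemma measurable_coord (d : nat) (i : 'I_d) :
  measurable_fun [set: 'rV[R]_d] (fun x => x ord0 i : measurableTypeR R).
Proof.
move=> _ Y mY; rewrite setTI; apply: sub_sigma_algebra => /=.
rewrite -bigcup_seq/=; exists i => /=; first by rewrite mem_index_enum.
by exists Y => //; rewrite setTI.
Qed.

Lemma measurable_snoc (d : nat) :
  measurable_fun [set: 'rV[R]_d * measurableTypeR R] (@snoc d).
Proof.
have msnoc (i : 'I_d.+1) :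
    measurable_fun [set: 'rV[R]_d * measurableTypeR R]
      (fun p => snoc p ord0 i : measurableTypeR R).
  case: (unliftP ord_max i) => [j ->|->].
    rewrite [X in measurable_fun _ X](_ : _ =
      (fun x : 'rV[R]_d => x ord0 j : measurableTypeR R) \o fst).
      exact: (measurableT_comp (@measurable_coord d j) measurable_fst).
    by apply/funext => p; rewrite /snoc mxE liftK.
  rewrite [X in measurable_fun _ X](_ : _ = snd); first exact: measurable_snd.
  by apply/funext => p; rewrite /snoc mxE unlift_none.
move=> _ Y mY; rewrite setTI.
suff : <<s \big[setU/set0]_(i < d.+1) preimage_set_system setT
    (fun x : 'rV[R]_d.+1 => x ord0 i : measurableTypeR R) measurable >>
    `<=` [set A | measurable (@snoc d @^-1` A)] by apply.
apply: smallest_sub => [|A].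
  split=> /= [|A mA|F mF].
  - by rewrite preimage_set0.
  - by rewrite setTD preimage_setC; exact: measurableC.
  - by rewrite preimage_bigcup; exact: bigcup_measurable.
rewrite -bigcup_seq/= => -[i _ [B mB <-]]; rewrite setTI /=.
by have := msnoc i measurableT B mB; rewrite setTI.
Qed.

Section snoc_measure.
Local Open Scope ereal_scope.
Variables (d : nat) (mu : {measure set 'rV[R]_d -> \bar R}).

Definition snoc_measure : set 'rV[R]_d.+1 -> \bar R :=
  pushforward (mu \x lebesgue_measure) (@snoc d).

Let snoc_measure0 : snoc_measure set0 = 0.
Proof. by rewrite /snoc_measure /pushforward preimage_set0 measure0. Qed.

Let snoc_measure_ge0 A : 0 <= snoc_measure A.
Proof. by rewrite /snoc_measure /pushforward; apply: measure_ge0. Qed.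

Let snoc_measure_sigma_additive : semi_sigma_additive snoc_measure.
Proof.
move=> F mF tF mUF; rewrite /snoc_measure /pushforward preimage_bigcup.
apply: measure_semi_sigma_additive.
- by move=> n; rewrite -[X in measurable X]setTI; exact: measurable_snoc.
- apply/trivIsetP => /= i j _ _ ij; rewrite -preimage_setI.
  by move/trivIsetP : tF => /(_ _ _ _ _ ij) ->//; rewrite preimage_set0.
- rewrite -preimage_bigcup -[X in measurable X]setTI.
  exact: measurable_snoc.
Qed.

HB.instance Definition _ := isMeasure.Build _ _ _ snoc_measure
  snoc_measure0 snoc_measure_ge0 snoc_measure_sigma_additive.

End snoc_measure.

(* [R^0] is a single point of mass 1, and Lebesgue measure on [R^d.+1] is the
   product of Lebesgue measures on [R^d] and on [R], transported by [snoc]. *)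
Fixpoint lebesgue_row (d : nat) : {measure set 'rV[R]_d -> \bar R} :=
  if d is n.+1 then snoc_measure (lebesgue_row n) else \d_(0 : 'rV[R]_0).

End lebesgue_row.

Section cn_sav.
Context {R : realType}.

Definition box (d : nat) (lo hi : 'rV[R]_d) : set 'rV[R]_d :=
  [set x | forall i, lo ord0 i < x ord0 i < hi ord0 i].

Lemma measurable_box (d : nat) (lo hi : 'rV[R]_d) : measurable (box lo hi).
Proof.
rewrite (_ : box lo hi = \bigcap_(i in [set: 'I_d])
   ((fun x : 'rV[R]_d => x ord0 i : measurableTypeR R)
      @^-1` `]lo ord0 i, hi ord0 i[%classic)).
  apply: fin_bigcap_measurable; first exact: finite_finset.
  move=> i _; rewrite -[X in measurable X]setTI.
  apply: measurable_coord; first exact: measurableT.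
  exact: (@measurable_itv R).
apply/seteqP; split => x /=.
  by move=> H i _ /=; rewrite in_itv /=; apply: H.
by move=> H i; have := H i I; rewrite /= in_itv.
Qed.

Lemma lebesgue_row_box (d : nat) (lo hi : 'rV[R]_d) :
  (forall i, lo ord0 i < hi ord0 i) ->
  lebesgue_row d (box lo hi) = (\prod_(i < d) (hi ord0 i - lo ord0 i))%:E.
Proof.
elim: d lo hi => [|d IH] lo hi H.
  rewrite big_ord0 /= diracE (_ : (0 \in box lo hi) = true) //.
  by apply/mem_set; case.
rewrite /= /snoc_measure /pushforward.
pose l' := \row_(j < d) lo ord0 (lift ord_max j).
pose h' := \row_(j < d) hi ord0 (lift ord_max j).
have -> : @snoc R d @^-1` box lo hi =
    box l' h' `*` `]lo ord0 ord_max, hi ord0 ord_max[%classic.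
  apply/seteqP; split => -[x y] /=.
    move=> B; split.
      by move=> j; have := B (lift ord_max j); rewrite /snoc !mxE liftK.
    by have := B ord_max; rewrite /snoc !mxE unlift_none in_itv.
  move=> [B1 B2] i; case: (unliftP ord_max i) => [j ->|->].
    by have := B1 j; rewrite /snoc !mxE liftK.
  by move: B2; rewrite /snoc !mxE unlift_none in_itv.
rewrite product_measure1E; [|exact: measurable_box|exact: (@measurable_itv R)].
rewrite IH; last by move=> i; rewrite !mxE.
rewrite [X in (_ * X)%E](@lebesgue_measure_itv R) /= lte_fin H -EFinB -EFinM.
rewrite big_ord_recr /=.
congr (_ * _)%:E; apply: eq_bigr => i _; rewrite !mxE.
by congr (hi _ _ - lo _ _); apply/val_inj; rewrite /= /bump leqNgt ltn_ord.
Qed.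

Definition volume (d : nat) (D : set 'rV[R]_d) : R := fine (lebesgue_row d D).

Definition unit_vec (d : nat) (i : 'I_d) : 'rV[R]_d := delta_mx ord0 i.

Definition box_periodic (d : nat) (lo hi : 'rV[R]_d) (f : 'rV[R]_d -> R) :=
  forall (i : 'I_d) (x : 'rV[R]_d),
    f (x + (hi ord0 i - lo ord0 i) *: unit_vec i) = f x.

Definition partial (d : nat) (i : 'I_d) (f : 'rV[R]_d -> R) : 'rV[R]_d -> R :=
  fun x => 'D_(unit_vec i) f x.

Definition classC1 (d : nat) (f : 'rV[R]_d -> R) :=
  continuous f /\
  forall i : 'I_d, (forall x, derivable f x (unit_vec i)) /\
                   continuous (partial i f).

Definition classC2 (d : nat) (f : 'rV[R]_d -> R) :=
  classC1 f /\ forall i : 'I_d, classC1 (partial i f).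

Definition laplacian (d : nat) (f : 'rV[R]_d -> R) : 'rV[R]_d -> R :=
  fun x => \sum_(i < d) partial i (partial i f) x.

Definition Gamma (z : R) : R :=
  \int[lebesgue_measure]_(s in `]0, +oo[) (s `^ (z - 1) * expR (- s)).

Definition omega (mu s : R) : R := s `^ (mu - 1) / Gamma mu.

Definition step (t : nat -> R) (k : nat) : R := t k - t k.-1.

Definition step_ratio (t : nat -> R) (k : nat) : R := step t k / step t k.+1.

Definition bdiff (w : nat -> R) (k : nat) : R := w k - w k.-1.

(* Quantities at the half level [k - 1/2] are indexed by [k]. *)
Definition dtau (t w : nat -> R) (k : nat) : R := bdiff w k / step t k.

Definition midval (w : nat -> R) (k : nat) : R := (w k + w k.-1) / 2.

(* [L1p_coef alpha t n k] is the coefficient of [bdiff w k], that is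
   a_{n-k}^{(n)}. *)
Definition L1p_coef (alpha : R) (t : nat -> R) (n k : nat) : R :=
  (step t n * step t k)^-1 *
  \int[lebesgue_measure]_(r in `[t n.-1, t n])
    \int[lebesgue_measure]_(s in `[t k.-1, Num.min r (t k)])
      omega (1 - alpha) (r - s).

Definition L1p (alpha : R) (t w : nat -> R) (n : nat) : R :=
  \sum_(1 <= k < n.+1) L1p_coef alpha t n k * bdiff w k.

Variables (d : nat) (D : set 'rV[R]_d).

Definition sav_root (beta C0 : R) (f : 'rV[R]_d -> R) : R :=
  Num.sqrt (\int[lebesgue_row d]_(x in D)
              (4^-1 * (f x ^+ 2 - 1 - beta) ^+ 2) + C0).

Definition sav_V (beta C0 : R) (f : 'rV[R]_d -> R) : 'rV[R]_d -> R :=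
  fun x => (f x ^+ 2 - 1 - beta) * f x / sav_root beta C0 f.

Definition extrapolation (t : nat -> R) (phihalf : 'rV[R]_d -> R)
    (phi : nat -> 'rV[R]_d -> R) (n : nat) : 'rV[R]_d -> R :=
  if (n <= 1)%N then phihalf
  else fun x => phi n.-1 x
         + bdiff (fun k => phi k x) n.-1 / (2 * step_ratio t n.-1).

Definition chem_potential (eps beta C0 : R) (t : nat -> R)
    (phihalf : 'rV[R]_d -> R) (phi : nat -> 'rV[R]_d -> R) (v : nat -> R)
    (n : nat) : 'rV[R]_d -> R :=
  let phimid := fun x => midval (fun k => phi k x) n in
  fun x => - eps ^+ 2 * laplacian phimid x + beta * phimid x
         + sav_V beta C0 (extrapolation t phihalf phi n) x * midval v n.

(* [eta n] and [phihalf] stand for eta^{n-1/2} and for the prescribed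
   extrapolation at level 1/2. *)
Record cn_sav_step (alpha lambda eps beta C0 : R) (t : nat -> R)
    (phihalf : 'rV[R]_d -> R) (phi : nat -> 'rV[R]_d -> R) (v eta : nat -> R)
    (n : nat) : Prop := CNSavStep {
  cn_sav_phi : forall x, D x ->
    L1p alpha t (fun k => phi k x) n =
    - lambda * (chem_potential eps beta C0 t phihalf phi v n x - eta n) ;
  cn_sav_eta :
    eta n = (volume D)^-1 *
      \int[lebesgue_row d]_(x in D) chem_potential eps beta C0 t phihalf phi v n x ;
  cn_sav_v :
    dtau t v n = 2^-1 *
      \int[lebesgue_row d]_(x in D)
        (sav_V beta C0 (extrapolation t phihalf phi n) x
         * dtau t (fun k => phi k x) n) }.

End cn_sav.

(* Main.v *)
Require Import Defs.
From HB Require Import structures.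
From mathcomp Require Import all_boot all_order all_algebra.
From mathcomp Require Import all_classical all_reals all_analysis.
From mathcomp Require Import measurable_realfun.
From mathcomp Require Import ring lra.

Set Implicit Arguments.
Unset Strict Implicit.
Unset Printing Implicit Defensive.

Import Order.TTheory GRing.Theory Num.Theory.
Import numFieldNormedType.Exports.

Local Open Scope classical_set_scope.
Local Open Scope ring_scope.

(** Integrate the evolution equation over the box. The scalar eta is by
    construction the mean of the chemical potential, so the right-hand side
    integrates to zero, and the L1+ operator, being a finite linear combination
    of increments, commutes with the integral. Hence the sequence w of the
    integrals of phi is annihilated by the L1+ operator at every level
    ([Rintegral_L1p_eq0]).

    The system L1p w = 0 is lower triangular in the increments of w, so these
    increments vanish one level after the other once the diagonal
    coefficients are nonzero ([L1p_eq0_stationary]). With p = 1 - alpha, the diagonal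
    coefficient is tau^(p+1) / (tau^2 p (p+1) Gamma(p)), where tau is the step;
    it is positive ([L1p_coef_diag_gt0]) because Gamma(p) is.

    Both halves rest on integrability: the real-valued integral of a function
    with infinite integral is a default value, so that neither linearity nor
    positivity is available for it. In space, the chemical potential of C2
    functions is continuous, and a continuous function is integrable on a
    bounded box ([continuous_integrable_box]). In time, the kernel
    (r - s)^(p - 1) and the integrand of Gamma blow up at an endpoint, which is
    handled by a fundamental theorem of calculus for nonnegative integrands on
    open intervals ([ge0_FTC2_oo]). *)

(** * Singular integrals and the diagonal L1+ coefficient *)

(** The integrand may be unbounded near both endpoints. Exhaust the open interval
    by compact ones, where the usual theorem applies: the integrals converge by
    monotone convergence, and the increments of [F] by continuity of [F] up to
    the boundary. *)
Lemma ge0_FTC2_oo (R : realType) (f F : R -> R) (a b : R) (b0 b1 : bool) :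
  a < b ->
  {in `]a, b[, forall x, 0 <= f x} ->
  {in `]a, b[, continuous f} ->
  derivable_oo_LRcontinuous F a b ->
  {in `]a, b[, F^`()%classic =1 f} ->
  (\int[lebesgue_measure]_(x in [set` Interval (BSide b0 a) (BSide b1 b)])
     (f x)%:E = (F b - F a)%:E)%E.
Proof.
move=> ab f0 cf dF F'f.
have mf : measurable_fun `]a, b[%classic f.
  apply: open_continuous_measurable_fun; first exact: interval_open.
  by move=> x; rewrite inE; exact: cf.
rewrite integral_itv_bndoo; last exact/measurable_EFinP.
(* The factor 1/3 keeps the shrunk interval nonempty already for [n = 0]. *)
pose h n := (b - a) / 3 * @harmonic R n.
have h0 n : 0 < h n by rewrite mulr_gt0 ?invr_gt0 ?divr_gt0 ?subr_gt0.
have h1 n : h n <= (b - a) / 3.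
  rewrite ler_piMr ?invf_le1 ?ler1n// divr_ge0 ?subr_ge0// ltW//.
have hh : h n @[n --> \oo] --> 0.
  rewrite -[X in _ --> X](mulr0 ((b - a) / 3)).
  by apply: cvgMr; exact: cvg_harmonic.
pose E n : set R := `[a + h n, b - h n]%classic.
have EU : \bigcup_n E n = `]a, b[%classic.
  apply/seteqP; split => x /=.
    move=> [n _]; rewrite /E/= !in_itv/= => /andP[ax xb].
    by have ? := h0 n; apply/andP; split; lra.
  rewrite in_itv/= => /andP[ax xb].
  have : \forall n \near \oo, h n < Num.min (x - a) (b - x).
    apply: (cvgr_lt 0) => //.
    by rewrite lt_min !subr_gt0 ax xb.
  move=> [n _ /(_ n (leqnn n))]/=; rewrite lt_min => /andP[H1 H2].
  by exists n => //; rewrite /E /= in_itv/=; apply/andP; split; lra.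
have EE n x : E n x -> x \in `]a, b[.
  move=> Enx; suff : `]a, b[%classic x by []. by rewrite -EU; exists n.
have cvgE : (\int[lebesgue_measure]_(x in E n) (f x)%:E @[n --> \oo] -->
   \int[lebesgue_measure]_(x in \bigcup_n E n) (f x)%:E)%E.
  apply: ge0_nondecreasing_set_cvg_integral.
  - apply/nondecreasing_seqP => n; rewrite subsetEset => x; rewrite /E/=.
    rewrite !in_itv/= => /andP[H1 H2].
    have : h n.+1 <= h n.
      by rewrite ler_wpM2l ?divr_ge0 ?subr_ge0 ?ltW// ltf_pV2 ?posrE// ltr_nat.
    by move=> ?; apply/andP; split; lra.
  - by move=> n; exact: measurable_itv.
  - move=> n; apply/measurable_EFinP; apply: measurable_funS mf => //.
    by rewrite -EU; exact: bigcup_sup.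
  - by move=> n x /EE ?; rewrite lee_fin f0.
rewrite -EU; apply: cvg_unique cvgE _ => //.
have -> : (fun n => \int[lebesgue_measure]_(x in E n) (f x)%:E)%E =
    (fun n => (F (b - h n) - F (a + h n))%:E).
  apply/funext => n; have := h0 n; have := h1 n => ? ?.
  have abn : a + h n < b - h n by lra.
  have sub x : x \in `]a + h n, b - h n[ -> x \in `]a, b[.
    by rewrite !in_itv/= => /andP[? ?]; apply/andP; split; lra.
  rewrite (@continuous_FTC2 _ f F)// ?EFinB//.
  - apply: continuous_in_subspaceT => x /set_mem Ex; exact/cf/(EE n).
  - case: dF => dF Fa Fb.
    have cF x : x \in `]a, b[ -> {for x, continuous F}.
      by move=> xab; apply/differentiable_continuous/derivable1_diffP/dF.
    split.
    + by move=> x /sub; exact: dF.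
    + apply/cvg_at_right_filter/cF.
      by rewrite in_itv/=; apply/andP; split; lra.
    + apply/cvg_at_left_filter/cF.
      by rewrite in_itv/=; apply/andP; split; lra.
  - by move=> x /sub; exact: F'f.
apply: cvg_EFin; first by apply: nearW.
case: dF => dF Fa Fb.
apply: cvgB.
- move/cvg_at_leftP : Fb; apply; split; first by move=> n; have := h0 n; lra.
  by rewrite -[X in _ --> X]subr0; apply: cvgB => //; exact: cvg_cst.
- move/cvg_at_rightP : Fa; apply; split; first by move=> n; have := h0 n; lra.
  by rewrite -[X in _ --> X]addr0; apply: cvgD => //; exact: cvg_cst.
Qed.

Lemma is_derive_powR_subr (R : realType) (p c a x : R) :
  a < x -> p != 0 ->
  is_derive x 1 (fun y => c / p * (y - a) `^ p) (c * (x - a) `^ (p - 1)).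
Proof.
move=> ax p0.
have dpow : is_derive (x - a) 1 (fun y => y `^ p) (p * (x - a) `^ (p - 1)).
  by apply: is_derive1_powR; rewrite subr_gt0.
have dsub : is_derive x 1 (fun y : R => y - a) 1.
  exact: is_derive_shift.
have dcomp := @is_derive1_comp _ (fun y => y `^ p) (fun y => y - a) _ _ _ dpow dsub.
apply: is_derive_eq; rewrite /GRing.scale/=.
by field.
Qed.

Lemma is_derive_subl_powR (R : realType) (p c b x : R) :
  x < b -> p != 0 ->
  is_derive x 1 (fun y => - (c / p * (b - y) `^ p)) (c * (b - x) `^ (p - 1)).
Proof.
move=> xb p0.
have dpow : is_derive (b - x) 1 (fun y => y `^ p) (p * (b - x) `^ (p - 1)).
  by apply: is_derive1_powR; rewrite subr_gt0.
have dsub : is_derive x 1 (fun y : R => b - y) (0 - 1).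
  exact: is_deriveB.
have dcomp := @is_derive1_comp _ (fun y => y `^ p) (fun y => b - y) _ _ _ dpow dsub.
apply: is_derive_eq; rewrite /GRing.scale/=.
by field.
Qed.

Lemma is_derive_continuous (R : realType) (f : R -> R) (x df : R) :
  is_derive x 1 f df -> {for x, continuous f}.
Proof. by move=> [df_ex _]; apply/differentiable_continuous/derivable1_diffP. Qed.

Lemma is_derive_derive1E (R : realType) (f : R -> R) (x df : R) :
  is_derive x 1 f df -> f^`()%classic x = df.
Proof. by move=> [_ <-]; rewrite derive1E. Qed.

Lemma powR_subr_continuous (R : realType) (p c a x : R) :
  a < x -> {for x, continuous (fun y => c * (y - a) `^ p)}.
Proof.
move=> ax.
apply: (@continuousM _ _ (cst c) (fun y => (y - a) `^ p)); first exact: cst_continuous.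
apply: (@continuous_comp _ _ _ (fun y => y - a) (fun y => y `^ p)).
  by apply: cvgB => //; exact: cvg_cst.
by apply/differentiable_continuous/derivable1_diffP/derivable_powR;
  rewrite in_itv/= andbT subr_gt0.
Qed.

Lemma powR_subl_continuous (R : realType) (p c b x : R) :
  x < b -> {for x, continuous (fun y => c * (b - y) `^ p)}.
Proof.
move=> xb.
apply: (@continuousM _ _ (cst c) (fun y => (b - y) `^ p)); first exact: cst_continuous.
apply: (@continuous_comp _ _ _ (fun y => b - y) (fun y => y `^ p)).
  by apply: cvgB => //; exact: cvg_cst.
by apply/differentiable_continuous/derivable1_diffP/derivable_powR;
  rewrite in_itv/= andbT subr_gt0.
Qed.

(** The exponent [p - 1] may be negative; its primitive, of exponent [p > 0], is
    still continuous at the endpoint. *)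
Lemma integral_powR_subr (R : realType) (p c a b : R) (b0 b1 : bool) :
  a < b -> 0 < p -> 0 <= c ->
  (\int[lebesgue_measure]_(x in [set` Interval (BSide b0 a) (BSide b1 b)])
     (c * (x - a) `^ (p - 1))%:E = (c / p * (b - a) `^ p)%:E)%E.
Proof.
move=> ab p0 c0; have p_neq0 : p != 0 by rewrite gt_eqF.
pose F y := c / p * (y - a) `^ p.
have dF x : a < x -> is_derive x 1 F (c * (x - a) `^ (p - 1)).
  by move=> ?; exact: is_derive_powR_subr.
rewrite (@ge0_FTC2_oo _ _ F)//.
- by rewrite /F subrr powR0// mulr0 subr0.
- by move=> x _; rewrite mulr_ge0 ?powR_ge0.
- by move=> x /[!in_itv]/= /andP[ax _]; exact: powR_subr_continuous.
- split.
  + by move=> x /[!in_itv]/= /andP[/dF[]].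
  + apply: cvgMr; rewrite subrr powR0//; apply/cvg_at_rightP => u [au ua].
    have /cvg_at_rightP := powR_cvg0 p0; apply; split.
      by move=> n; rewrite subr_gt0.
    by rewrite -(subrr a); apply: cvgB => //; exact: cvg_cst.
  + exact/cvg_at_left_filter/is_derive_continuous/dF.
- by move=> x /[!in_itv]/= /andP[/dF/is_derive_derive1E].
Qed.

Lemma integral_powR_subl (R : realType) (p c a b : R) (b0 b1 : bool) :
  a < b -> 0 < p -> 0 <= c ->
  (\int[lebesgue_measure]_(x in [set` Interval (BSide b0 a) (BSide b1 b)])
     (c * (b - x) `^ (p - 1))%:E = (c / p * (b - a) `^ p)%:E)%E.
Proof.
move=> ab p0 c0; have p_neq0 : p != 0 by rewrite gt_eqF.
pose F y := - (c / p * (b - y) `^ p).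
have dF x : x < b -> is_derive x 1 F (c * (b - x) `^ (p - 1)).
  by move=> ?; exact: is_derive_subl_powR.
rewrite (@ge0_FTC2_oo _ _ F)//.
- by rewrite /F subrr powR0// mulr0 oppr0 sub0r opprK.
- by move=> x _; rewrite mulr_ge0 ?powR_ge0.
- by move=> x /[!in_itv]/= /andP[_ xb]; exact: powR_subl_continuous.
- split.
  + by move=> x /[!in_itv]/= /andP[_ /dF[]].
  + exact/cvg_at_right_filter/is_derive_continuous/dF.
  + rewrite /F subrr powR0//; apply: cvgN; apply: cvgMr.
    apply/cvg_at_leftP => u [ub cu].
    have /cvg_at_rightP := powR_cvg0 p0; apply; split.
      by move=> n; rewrite subr_gt0.
    by rewrite -(subrr b); apply: cvgB => //; exact: cvg_cst.
- by move=> x /[!in_itv]/= /andP[_ /dF/is_derive_derive1E].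
Qed.

(** If the integral were zero, [f] would vanish almost everywhere on [D], that is,
    [D] would be contained in a null set. *)
Lemma integral_gt0 d (T : measurableType d) (R : realType)
    (mu : {measure set T -> \bar R}) (D : set T) (f : T -> \bar R) :
  measurable D -> measurable_fun D f -> (forall x, D x -> 0 < f x)%E ->
  (0 < mu D)%E -> (0 < \int[mu]_(x in D) f x)%E.
Proof.
move=> mD mf f0 muD.
rewrite lt_neqAle integral_ge0 ?andbT; last by move=> x /f0/ltW.
apply/eqP => I0.
have /ae_eq_integral_abs : (\int[mu]_(x in D) `|f x| = 0)%E.
  by rewrite I0; apply: eq_integral => x /set_mem/f0/ltW/gee0_abs.
move=> /(_ mD mf)[N [mN N0 DN]].
suff : (mu D <= mu N)%E by rewrite N0 leNgt muD.
apply: le_measure; rewrite ?inE// => x Dx; apply: DN => /= /(_ Dx) fx.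
by have := f0 _ Dx; rewrite fx ltxx.
Qed.

(** The integrand is positive, so the point is that its integral is finite: it is
    dominated by [s^(z - 1)] on ]0, 1], and by [exp(- s)] on ]1, +oo[ since
    [z <= 1]. *)
Lemma Gamma_gt0 (R : realType) (z : R) : 0 < z <= 1 -> 0 < Gamma z.
Proof.
move=> /andP[z0 z1].
pose f (s : R) := s `^ (z - 1) * expR (- s).
have f_gt0 s : 0 < s -> 0 < f s by move=> s0; rewrite mulr_gt0 ?powR_gt0 ?expR_gt0.
have mpow D : measurable_fun D (fun s : R => s `^ (z - 1)).
  exact: measurable_funTS.
have mexp D : measurable_fun D (fun s : R => expR (- s)).
  by apply: measurable_funTS; apply: measurableT_comp => //; exact: oppr_measurable.
have mf D : measurable_fun D (EFin \o f).
  by apply/measurable_EFinP/measurable_funM.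
have mEpow D : measurable_fun D (fun s : R => (s `^ (z - 1))%:E).
  exact/measurable_EFinP.
have mEexp D : measurable_fun D (fun s : R => (expR (- s))%:E).
  exact/measurable_EFinP.
apply: fine_gt0; apply/andP; split.
  apply: integral_gt0 => //; first exact: mf.
  - by move=> x /= /[!in_itv]/= /[!andbT] x0; rewrite lte_fin f_gt0.
  - by rewrite [ltRHS](@lebesgue_measure_itv R) /= ltry ltry.
have -> : `]0, +oo[%classic = `]0, 1]%classic `|` `]1, +oo[%classic :> set R.
  apply/seteqP; split => x /=; rewrite !in_itv/= !andbT.
    by move=> x0; have [x1|x1] := leP x 1; [left; rewrite x0|right].
  by move=> [/andP[]//|]; apply: lt_trans.
rewrite ge0_integral_setU//; last 3 first.
- exact: mf.
- by move=> x [|] /= /[!in_itv]/= => [/andP[? _]|/[!andbT] ?];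
    rewrite lee_fin ltW// f_gt0// (lt_trans _ (_ : 1 < x)).
- apply/disj_set2P; rewrite -subset0 => x [] /=; rewrite !in_itv/= andbT.
  by move=> /andP[_]; rewrite leNgt => /negP.
apply: lte_add_pinfty.
- have pow_fin : (\int[lebesgue_measure]_(s in `]0%R, 1%R]%classic)
      (s `^ (z - 1))%:E < +oo)%E.
    under eq_integral do rewrite -[X in X `^ _]subr0 -[X in X%:E]mul1r.
    by rewrite integral_powR_subr// ltry.
  apply: le_lt_trans pow_fin; apply: ge0_le_integral => //.
  + by move=> x /= /[!in_itv]/= /andP[x0 _]; rewrite lee_fin ltW// f_gt0.
  + exact: mf.
  + exact: mEpow.
  + move=> x /= /[!in_itv]/= /andP[x0 _]; rewrite lee_fin.
    by rewrite /f ler_piMr ?powR_ge0// expR_le1 oppr_le0 ltW.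
- apply: (@le_lt_trans _ _ (\int[lebesgue_measure]_(s in `]1%R, +oo[%classic)
      (expR (- s))%:E)%E).
    apply: ge0_le_integral => //.
    + move=> x /= /[!in_itv]/= /[!andbT] x1.
      by rewrite lee_fin ltW// f_gt0// (lt_trans _ x1).
    + exact: mf.
    + exact: mEexp.
    + move=> x /= /[!in_itv]/= /[!andbT] x1; rewrite lee_fin.
      rewrite /f ler_piMl ?expR_ge0//.
      by rewrite -[leRHS](powRr0 x) ler_powR ?(ltW x1)// subr_le0.
have dexp s : is_derive s (1 : R) (fun s : R => expR (- s)) (- expR (- s)).
  have := @is_derive1_comp R expR -%R s _ _ (is_derive_expR (- s))
    (is_deriveN (is_derive_id s 1)).
  by rewrite mulrN1.
have dNexp s : is_derive s (1 : R) (fun s : R => - expR (- s)) (expR (- s)).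
  by have := is_deriveN (dexp s); rewrite opprK.
rewrite integral_itv_obnd_cbnd; last exact: mEexp.
rewrite (@ge0_continuous_FTC2y _ _ (fun s => - expR (- s)) _ 0) ?ltry//.
- by apply/continuous_subspaceT => s; exact: is_derive_continuous (dexp s).
- rewrite -[X in _ --> X]oppr0; apply: cvgN; exact: cvgr_expR.
- apply/cvg_at_right_filter; exact: is_derive_continuous.
- move=> s _; exact: is_derive_derive1E.
Qed.

(** Both integrals are explicit. The inner one runs up to the singularity of the
    kernel and equals [(r - t_{n-1})^p / (p Gamma(p))], [p = 1 - alpha]; the outer
    one integrates this power once more. *)
Lemma L1p_coef_diag_gt0 (R : realType) (alpha : R) (t : nat -> R) (n : nat) :
  0 < alpha < 1 -> t n.-1 < t n -> 0 < L1p_coef alpha t n n.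
Proof.
move=> /andP[alpha0 alpha1] tn.
have p_gt0 : 0 < 1 - alpha by rewrite subr_gt0.
set p := 1 - alpha in p_gt0 *.
have G0 : 0 < Gamma p by apply: Gamma_gt0; rewrite p_gt0 gerBl ltW.
(* The exponent is written [p + 1 - 1] to match [integral_powR_subr] at [p + 1]. *)
have inner r : r \in `[t n.-1, t n]%classic ->
    \int[lebesgue_measure]_(s in `[t n.-1, Num.min r (t n)]) omega p (r - s) =
    (Gamma p)^-1 / p * (r - t n.-1) `^ (p + 1 - 1).
  rewrite inE/= in_itv/= => /andP[tr rt].
  rewrite min_l// addrK; move: tr; rewrite le_eqVlt => /predU1P[<-|tr].
    by rewrite set_itv1 Rintegral_set1 subrr powR0 ?mulr0// gt_eqF.
  rewrite /Rintegral /omega.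
  under eq_integral do rewrite mulrC.
  by rewrite integral_powR_subl// invr_ge0 ltW.
rewrite /L1p_coef -/p mulr_gt0 ?invr_gt0 ?mulr_gt0 /step ?subr_gt0//.
rewrite [ltRHS](_ : _ = \int[lebesgue_measure]_(r in `[t n.-1, t n])
    ((Gamma p)^-1 / p * (r - t n.-1) `^ (p + 1 - 1))); last first.
  by apply: eq_Rintegral => r rin; exact: inner.
rewrite /Rintegral integral_powR_subr//=.
- have c0 : 0 < (Gamma p)^-1 / p / (p + 1).
    by apply: divr_gt0; [apply: divr_gt0; rewrite ?invr_gt0|exact: addr_gt0].
  by rewrite mulr_gt0 ?powR_gt0 ?subr_gt0.
- exact: addr_gt0.
- by apply: divr_ge0; rewrite ?invr_ge0 ltW.
Qed.

(** * Integrability of continuous functions on a box *)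

(** The product sigma-algebra contains the boxes, and every open set is a
    countable union of boxes with rational corners. *)
Lemma open_row_measurable (R : realType) (d : nat) (U : set 'rV[R]_d) :
  open U -> measurable U.
Proof.
move=> oU.
pose B (q : 'rV[rat]_d * 'rV[rat]_d) : set 'rV[R]_d :=
  box (map_mx ratr q.1) (map_mx ratr q.2).
suff -> : U = \bigcup_(q : {q | `[< B q `<=` U >]}) B (val q).
  apply: countable_bigcupT_measurable; first exact: countableP.
  by move=> q; exact: measurable_box.
apply/seteqP; split=> [x Ux|x [[q /= /asboolP BU] _ Bx]]; last exact: BU.
have /nbhs_ballP[e /= e0 eU] : nbhs x U by exact: open_nbhs_nbhs.
have lo_ex (i : 'I_d) : exists q : rat, ratr q \in `]x ord0 i - e, x ord0 i[.
  by apply: rat_in_itvoo; rewrite ltrBlDr ltrDl.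
have hi_ex (i : 'I_d) : exists q : rat, ratr q \in `]x ord0 i, x ord0 i + e[.
  by apply: rat_in_itvoo; rewrite ltrDl.
pose q := (\row_i projT1 (cid (lo_ex i)), \row_i projT1 (cid (hi_ex i))).
have qlo i : x ord0 i - e < ratr (q.1 ord0 i) < x ord0 i.
  by rewrite mxE; case: cid => /= r; rewrite in_itv.
have qhi i : x ord0 i < ratr (q.2 ord0 i) < x ord0 i + e.
  by rewrite mxE; case: cid => /= r; rewrite in_itv.
have BU : `[< B q `<=` U >].
  apply/asboolP => y By; apply: eU; split=> // i j; rewrite (ord1 i).
  rewrite /ball/= ltr_norml; have := By j; rewrite !mxE => /andP[ylo yhi].
  move: (qlo j) (qhi j); rewrite !mxE => /andP[? ?] /andP[? ?].
  by apply/andP; split; lra.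
exists (exist _ q BU) => //= i; rewrite !mxE.
have /andP[_ lox] := qlo i; have /andP[xhi _] := qhi i.
by move: lox xhi; rewrite !mxE => -> ->.
Qed.

Lemma continuous_row_measurable (R : realType) (d : nat) (f : 'rV[R]_d -> R) :
  continuous f -> measurable_fun setT f.
Proof.
move=> /continuousP cf.
apply: (measurability _ (RGenOpens.measurableE R)).
move=> _ [_ [a [b ->] <-]]; rewrite setTI.
by apply: open_row_measurable; apply: cf; exact: interval_open.
Qed.

(** The box has finite measure, and its closure is compact, so a continuous
    function is bounded on it. *)
Lemma continuous_integrable_box (R : realType) (d : nat) (lo hi : 'rV[R]_d)
    (f : 'rV[R]_d -> R) :
  (forall i, lo ord0 i < hi ord0 i) -> continuous f ->
  (lebesgue_row d).-integrable (box lo hi) (EFin \o f).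
Proof.
move=> lohi cf; apply: measurable_bounded_integrable.
- exact: measurable_box.
- by rewrite lebesgue_row_box// ltry.
- by apply: measurable_funTS; exact: continuous_row_measurable.
pose K : set 'rV[R]_d := [set x | forall i, `[lo ord0 i, hi ord0 i]%classic (x ord0 i)].
have cK : compact K.
  apply: (@rV_compact R d (fun i => `[lo ord0 i, hi ord0 i]%classic)) => i.
  exact: segment_compact.
have /compact_bounded[M [Mreal HM]] :=
  continuous_compact (continuous_subspaceT cf) cK.
exists M; split => // r Mr x bx; apply: (HM r Mr); exists x => // i.
by have /andP[? ?] := bx i; rewrite /= in_itv/= !ltW.
Qed.

(** * Regularity of the chemical potential *)

Lemma partial_lincomb (R : realType) (d : nat) (i : 'I_d) (a b : R)
    (f g : 'rV[R]_d -> R) :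
  (forall x, derivable f x (unit_vec i)) ->
  (forall x, derivable g x (unit_vec i)) ->
  partial i (fun x => a * f x + b * g x) =
  (fun x => a * partial i f x + b * partial i g x).
Proof.
move=> df dg; apply/funext => x; rewrite /partial.
rewrite (_ : (fun x => _) = a *: f + b *: g)//.
by rewrite deriveD ?deriveZ//; exact: derivableZ.
Qed.

Lemma continuous_lincomb (R : realType) (T : topologicalType) (a b : R) (f g : T -> R) :
  continuous f -> continuous g -> continuous (fun x => a * f x + b * g x).
Proof.
move=> cf cg x; apply: cvgD; apply: cvgM; try exact: cvg_cst.
  exact: cf.
exact: cg.
Qed.

Lemma classC1_lincomb (R : realType) (d : nat) (a b : R) (f g : 'rV[R]_d -> R) :
  classC1 f -> classC1 g -> classC1 (fun x => a * f x + b * g x).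
Proof.
move=> [cf df] [cg dg]; split; first exact: continuous_lincomb.
move=> i; have [dfi cfi] := df i; have [dgi cgi] := dg i; split.
  by move=> x; apply: derivableD; apply: derivableZ.
by rewrite partial_lincomb//; exact: continuous_lincomb.
Qed.

Lemma classC2_lincomb (R : realType) (d : nat) (a b : R) (f g : 'rV[R]_d -> R) :
  classC2 f -> classC2 g -> classC2 (fun x => a * f x + b * g x).
Proof.
move=> [f1 f2] [g1 g2]; split; first exact: classC1_lincomb.
move=> i; rewrite partial_lincomb; first exact: classC1_lincomb.
  by move=> x; have [_ /(_ i)[]] := f1.
by move=> x; have [_ /(_ i)[]] := g1.
Qed.

Lemma continuous_laplacian (R : realType) (d : nat) (f : 'rV[R]_d -> R) :
  classC2 f -> continuous (laplacian f).
Proof.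
move=> [_ f2]; apply: continuous_big => [|i _]; first exact: add_continuous.
by have [_ /(_ i)[]] := f2 i.
Qed.

(** The mid-level function and, from the second level on, the extrapolation are
    linear combinations of C2 functions, and the nonlinear term is a cubic polynomial of the extrapolation
    divided by a constant. *)
Lemma chem_potential_continuous (R : realType) (d : nat) (D : set 'rV[R]_d)
    (eps beta C0 : R) (t : nat -> R) (phihalf : 'rV[R]_d -> R)
    (phi : nat -> 'rV[R]_d -> R) (v : nat -> R) (n : nat) :
  (0 < n)%N -> classC2 phihalf -> (forall k, (k <= n)%N -> classC2 (phi k)) ->
  continuous (chem_potential D eps beta C0 t phihalf phi v n).
Proof.
move=> n_gt0 C2half C2phi; rewrite /chem_potential.
set phimid := (fun x => midval _ n).
have C2mid : classC2 phimid.
  rewrite (_ : phimid = (fun x => 2^-1 * phi n x + 2^-1 * phi n.-1 x)).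
    by apply: classC2_lincomb; apply: C2phi => //; exact: leq_pred.
  by apply/funext => x; rewrite /phimid /midval; field.
have cext : continuous (extrapolation t phihalf phi n).
  rewrite /extrapolation; case: ifPn => [_|n_gt1]; first by have [[]] := C2half.
  have c1 : continuous (phi n.-1) by have [[]] := C2phi _ (leq_pred n).
  have c2 : continuous (phi n.-1.-1).
    by have [[]] := C2phi n.-1.-1 (leq_trans (leq_pred _) (leq_pred _)).
  pose r := (2 * step_ratio t n.-1)^-1.
  rewrite (_ : (fun x => _) = fun x => (1 + r) * phi n.-1 x + (- r) * phi n.-1.-1 x).
    exact: continuous_lincomb.
  by apply/funext => x; rewrite /bdiff -/r; ring.
have cmid : continuous phimid by have [[]] := C2mid.
have clap := continuous_laplacian C2mid.
set ext := extrapolation t phihalf phi n in cext *.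
rewrite /sav_V; set S := sav_root _ _ _ _.
pose W (y : R) := (y ^+ 2 - 1 - beta) * y / S * midval v n.
have cW : continuous W.
  move=> y; apply: cvgMl; apply: cvgMl; apply: cvgM; last exact: cvg_id.
  apply: cvgB; last exact: cvg_cst.
  apply: cvgB; last exact: cvg_cst.
  exact: exprn_continuous.
have cWext : continuous (W \o ext).
  by move=> x; apply: continuous_comp; [exact: cext|exact: cW].
rewrite (_ : (fun x => _) = fun x =>
    1 * (- eps ^+ 2 * laplacian phimid x + beta * phimid x) + 1 * (W \o ext) x).
  by do 2 apply: continuous_lincomb => //.
by apply/funext => x; rewrite !mul1r.
Qed.

(** * Volume balance of one step and triangular solve *)

Lemma Rintegral_sum d (T : measurableType d) (R : realType)
    (mu : {measure set T -> \bar R}) (D : set T) (I : eqType) (s : seq I)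
    (f : I -> T -> R) :
  measurable D -> (forall i, i \in s -> mu.-integrable D (EFin \o f i)) ->
  \int[mu]_(x in D) (\sum_(i <- s) f i x) =
  \sum_(i <- s) \int[mu]_(x in D) f i x.
Proof.
move=> mD; elim: s => [_|i s IHs fint].
  by under eq_Rintegral do rewrite big_nil; rewrite Rintegral_cst// mul0r big_nil.
have fs j : j \in s -> mu.-integrable D (EFin \o f j).
  by move=> js; apply: fint; rewrite inE js orbT.
rewrite big_cons -IHs// -RintegralD//.
- by apply: eq_Rintegral => x _; rewrite big_cons.
- by apply: fint; rewrite mem_head.
- rewrite (_ : _ \o _ = fun x => (\sum_(j <- s | j \in s) (f j x)%:E)%E).
    by apply: integrable_sum => // j js; exact: fs.
  by apply/funext => x; rewrite /= -sumEFin big_seq.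
Qed.

Lemma Rintegral_L1p d (T : measurableType d) (R : realType)
    (mu : {measure set T -> \bar R}) (D : set T)
    (alpha : R) (t : nat -> R) (phi : nat -> T -> R) (n : nat) :
  measurable D ->
  (forall k, (k <= n)%N -> mu.-integrable D (EFin \o phi k)) ->
  \int[mu]_(x in D) L1p alpha t (fun k => phi k x) n =
  L1p alpha t (fun k => \int[mu]_(x in D) phi k x) n.
Proof.
move=> mD phi_int; rewrite /L1p /bdiff.
have phi_int' k : k \in index_iota 1 n.+1 ->
    mu.-integrable D (EFin \o phi k) /\ mu.-integrable D (EFin \o phi k.-1).
  rewrite mem_index_iota ltnS => /andP[_ kn].
  by split; apply: phi_int => //; exact: leq_trans (leq_pred k) kn.
have dphi_int k : k \in index_iota 1 n.+1 ->
    mu.-integrable D (EFin \o (fun x => phi k x - phi k.-1 x)).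
  move=> /phi_int'[ik ik']; rewrite (_ : _ \o _ =
    (fun x => (EFin \o phi k) x - (EFin \o phi k.-1) x)%E) ?integrableB//.
rewrite Rintegral_sum//; last first.
  move=> k /dphi_int ik; rewrite (_ : _ \o _ = (fun x => (L1p_coef alpha t n k)%:E *
     (phi k x - phi k.-1 x)%:E)%E); first exact: integrableZl.
  by apply/funext => x /=; rewrite EFinM.
rewrite big_seq [RHS]big_seq; apply: eq_bigr => k kn.
by have [? ?] := phi_int' k kn; rewrite RintegralZl ?RintegralB//; exact: dphi_int.
Qed.

(** [eta n] is the mean of the chemical potential, so their difference has zero
    integral. *)
Lemma Rintegral_L1p_eq0 (R : realType) (d : nat) (lo hi : 'rV[R]_d)
    (alpha lambda eps beta C0 : R) (t : nat -> R)
    (phihalf : 'rV[R]_d -> R) (phi : nat -> 'rV[R]_d -> R) (v eta : nat -> R)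
    (n : nat) :
  (forall i, lo ord0 i < hi ord0 i) -> (0 < n)%N ->
  classC2 phihalf -> (forall k, (k <= n)%N -> classC2 (phi k)) ->
  cn_sav_step (box lo hi) alpha lambda eps beta C0 t phihalf phi v eta n ->
  \int[lebesgue_row d]_(x in box lo hi) L1p alpha t (fun k => phi k x) n = 0.
Proof.
move=> lohi n_gt0 C2half C2phi [phi_eq eta_eq _].
set pot := chem_potential _ _ _ _ _ _ _ _ _ in phi_eq eta_eq.
have mbox : measurable (box lo hi) by exact: measurable_box.
have pot_int : (lebesgue_row d).-integrable (box lo hi) (EFin \o pot).
  by apply: continuous_integrable_box => //; exact: chem_potential_continuous.
have eta_int : (lebesgue_row d).-integrable (box lo hi) (EFin \o cst (eta n)).
  by apply: continuous_integrable_box => //; exact: cst_continuous.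
have vol_neq0 : volume (box lo hi) != 0.
  rewrite /volume lebesgue_row_box//= gt_eqF// prodr_gt0// => i _.
  by rewrite subr_gt0.
have diff_int : (lebesgue_row d).-integrable (box lo hi)
    (EFin \o (fun x => pot x - eta n)).
  by rewrite (_ : _ \o _ = (fun x => (EFin \o pot) x - (EFin \o cst (eta n)) x)%E)
    ?integrableB.
transitivity (\int[lebesgue_row d]_(x in box lo hi) (- lambda * (pot x - eta n))).
  by apply: eq_Rintegral => x /set_mem; exact: phi_eq.
rewrite RintegralZl// RintegralB//.
rewrite Rintegral_cst// -/(volume _) eta_eq mulrAC mulVf// mul1r.
by rewrite subrr mulr0.
Qed.

(** By strong induction the earlier increments are zero, which leaves only the
    diagonal term of the L1+ sum. *)
Lemma L1p_eq0_stationary (R : realType) (alpha : R) (t w : nat -> R) (N : nat) :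
  (forall n, (1 <= n <= N)%N -> L1p_coef alpha t n n != 0) ->
  (forall n, (1 <= n <= N)%N -> L1p alpha t w n = 0) ->
  forall n, (1 <= n <= N)%N -> w n = w n.-1.
Proof.
move=> coef_neq0 L1p_eq0; elim/ltn_ind => n IHn nN.
have /eqP := L1p_eq0 n nN; have /andP[n_gt0 n_le] := nN.
rewrite /L1p big_nat_recr//= big_nat big1 => [|k /andP[k_gt0 kn]]; last first.
  by rewrite /bdiff IHn ?subrr ?mulr0// k_gt0 (leq_trans (ltnW kn)).
by rewrite add0r mulf_eq0 (negbTE (coef_neq0 n nN)) subr_eq0 => /eqP.
Qed.

Theorem theorem3p3 (R : realType) (d : nat) (lo hi : 'rV[R]_d)
    (alpha lambda eps beta C0 T : R) (N : nat) (t : nat -> R)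
    (phi0 phihalf : 'rV[R]_d -> R) (phi : nat -> 'rV[R]_d -> R)
    (v eta : nat -> R)
    (d_gt0 : (0 < d)%N)
    (lo_lt_hi : forall i : 'I_d, lo ord0 i < hi ord0 i)
    (alpha01 : 0 < alpha < 1) (lambda_gt0 : 0 < lambda) (eps_gt0 : 0 < eps)
    (C0_gt0 : 0 < C0)
    (N_gt0 : (0 < N)%N) (t_init : t 0%N = 0) (t_final : t N = T)
    (t_incr : forall k, (k < N)%N -> t k < t k.+1)
    (phi_C2 : forall n, (n <= N)%N -> classC2 (phi n))
    (phi_per : forall n, (n <= N)%N -> box_periodic lo hi (phi n))
    (phihalf_C2 : classC2 phihalf) (phihalf_per : box_periodic lo hi phihalf)
    (phi_init : phi 0%N = phi0)
    (v_init : v 0%N = sav_root (box lo hi) beta C0 phi0)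
    (scheme : forall n, (1 <= n <= N)%N ->
       cn_sav_step (box lo hi) alpha lambda eps beta C0 t phihalf phi v eta n) :
  forall n, (1 <= n <= N)%N ->
    \int[lebesgue_row d]_(x in box lo hi) phi n x =
    \int[lebesgue_row d]_(x in box lo hi) phi n.-1 x.
Proof.
have coef_neq0 n : (1 <= n <= N)%N -> L1p_coef alpha t n n != 0.
  move=> /andP[n_gt0 nN]; rewrite gt_eqF// L1p_coef_diag_gt0//.
  by have := t_incr n.-1; rewrite prednK//; apply.
apply: (L1p_eq0_stationary coef_neq0) => n /[dup] nN /andP[n_gt0 n_le].
have C2phi k : (k <= n)%N -> classC2 (phi k).
  by move=> kn; apply: phi_C2; exact: leq_trans kn n_le.
rewrite -Rintegral_L1p; first exact: Rintegral_L1p_eq0 (scheme n nN).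
  exact: measurable_box.
move=> k /C2phi[[phi_cont _] _]; exact: continuous_integrable_box.
Qed.
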